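(* For every finite simple graph $\Gamma$ with adjacency matrix $A(\Gamma)$, $\mathrm{rank}(I+A(\Gamma))\le |V(S\Omega(\Gamma))|$.
   Context: For a graph $\Gamma$, consider partitions of $V(\Gamma)$ into nonempty parts such that each part induces a complete subgraph and, for any two distinct parts $P,Q$, either every vertex of $P$ is adjacent to every vertex of $Q$ or no vertex of $P$ is adjacent to any vertex of $Q$. The complete skeleton $\Omega(\Gamma)$ is such a partition with the minimum number of parts; its structure $S\Omega(\Gamma)$ is the simple graph whose vertices are the parts, two parts being adjacent iff they are completely joined. Rank is over the reals. *)

(* Defs.v *)
From mathcomp Require Import all_boot all_order all_algebra.
From mathcomp Require Import reals.

Set Implicit Arguments.
Unset Strict Implicit.
Unset Printing Implicit Defensive.

Import GRing.Theory.

Record sgraph := SGraph {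
  vertex :> finType;
  adj : rel vertex;
  adj_sym : symmetric adj;
  adj_irrefl : irreflexive adj
}.

(* Rows and columns are indexed by vertices in the order of [enum G]. *)
Definition adjacency_mx (R : pzSemiRingType) (G : sgraph) : 'M[R]_#|G| :=
  \matrix_(i, j) (adj (enum_val i) (enum_val j))%:R%R.

Section CompleteSkeleton.

Variable G : sgraph.
Implicit Types (P Q : {set G}) (W : {set {set G}}).

Definition complete_set P : bool :=
  [forall x in P, forall y in P, (x != y) ==> adj x y].

Definition completely_joined P Q : bool :=
  [forall x in P, forall y in Q, adj x y].

Definition completely_disjoined P Q : bool :=
  [forall x in P, forall y in Q, ~~ adj x y].

(* [partition W [set: G]] includes the requirement that parts be nonempty. *)
Definition complete_partition W : bool :=
  [&& partition W [set: G],
      [forall P in W, complete_set P] &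
      [forall P in W, forall Q in W,
        (P != Q) ==> completely_joined P Q || completely_disjoined P Q]].

Definition is_complete_skeleton W : Prop :=
  complete_partition W /\
  forall W', complete_partition W' -> #|W| <= #|W'|.

Lemma complete_partition_singletons : complete_partition [set [set x] | x : G].
Proof.
apply/and3P; split.
- apply/and3P; split.
  + apply/eqP/setP=> x; rewrite inE; apply/bigcupP.
    by exists [set x]; rewrite ?inE ?imset_f.
  + apply/trivIsetP=> _ _ /imsetP[x _ ->] /imsetP[y _ ->] nxy.
    rewrite disjoints1 inE; apply: contraNN nxy => /eqP->; exact: eqxx.
  + apply/imsetP=> -[x _ /setP/(_ x)]; by rewrite !inE eqxx.
- apply/forall_inP=> _ /imsetP[x _ ->]; apply/forall_inP=> y /set1P->.
  by apply/forall_inP=> z /set1P->; rewrite eqxx.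
- apply/forall_inP=> _ /imsetP[x _ ->]; apply/forall_inP=> _ /imsetP[y _ ->].
  apply/implyP=> _; case: (boolP (adj x y)) => exy; apply/orP; [left|right];
  by apply/forall_inP=> u /set1P->; apply/forall_inP=> v /set1P->.
Qed.

Lemma complete_skeleton_exists : exists W, is_complete_skeleton W.
Proof.
case: (arg_minnP (fun W : {set {set G}} => #|W|) complete_partition_singletons).
by move=> W HW minW; exists W; split.
Qed.

Definition structure_adj W : rel {P : {set G} | P \in W} :=
  fun p q => (p != q) && completely_joined (val p) (val q).

Fact structure_adj_sym W : symmetric (@structure_adj W).
Proof.
suff H P Q : completely_joined P Q -> completely_joined Q P.
  by move=> p q; rewrite /structure_adj eq_sym; congr andb; apply/idP/idP=> /H.
move=> /forall_inP PQ; apply/forall_inP=> y Qy; apply/forall_inP=> x Px.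
by rewrite adj_sym (forall_inP (PQ x Px)).
Qed.

Fact structure_adj_irrefl W : irreflexive (@structure_adj W).
Proof. by move=> p; rewrite /structure_adj eqxx. Qed.

Definition skeleton_structure W : sgraph :=
  SGraph (@structure_adj_sym W) (@structure_adj_irrefl W).

End CompleteSkeleton.

(* Main.v *)
(** Vertices in the same part have the same closed neighbourhood, hence the same
    row in I + A, so the distinct rows are at most as many as the parts. *)

Require Import Defs.
From mathcomp Require Import all_boot all_order all_algebra.
From mathcomp Require Import reals.

(** Repeating rows of a matrix with one row per part yields $I+A$, so its row space lies in one
    spanned by as many vectors as there are parts. [complete_partition_closed_nbhd] makes the row of
    a part well defined; [complete_partition_rank] does the factorization. *)

Lemma complete_partition_closed_nbhd (G : sgraph) (W : {set {set G}})
    (P : {set G}) (x x' y : G) :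
  complete_partition W -> P \in W -> x \in P -> x' \in P ->
  (x == y) || adj x y -> (x' == y) || adj x' y.
Proof.
move=> /and3P[/and3P[/eqP covW _ _] /forall_inP cplW /forall_inP joinW].
move=> PW xP x'P xy.
have [yP | yNP] := boolP (y \in P).
  have /forall_inP/(_ _ x'P)/forall_inP/(_ _ yP) := cplW _ PW.
  by case: eqP.
have /bigcupP[Q QW yQ] : y \in cover W by rewrite covW inE.
have nPQ : P != Q by apply: contraNneq yNP => ->.
have {}xy : adj x y by case: eqP xy => // xy _; rewrite -xy xP in yNP.
(* The edge from [x] to [y] rules out the disjoined case. *)
have /forall_inP/(_ _ QW)/implyP/(_ nPQ)/orP[] := joinW _ PW.
  by move=> /forall_inP/(_ _ x'P)/forall_inP/(_ _ yQ) ->; rewrite orbT.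
by move=> /forall_inP/(_ _ xP)/forall_inP/(_ _ yQ); rewrite xy.
Qed.

Lemma complete_partition_rank (F : fieldType) (G : sgraph) (W : {set {set G}}) :
  complete_partition W ->
  \rank (1%:M + adjacency_mx F G)%R <= #|skeleton_structure W|.
Proof.
move=> hW; have /and3P[/and3P[/eqP covW trivW _] _ _] := hW.
have pblockW x : pblock W x \in W by rewrite pblock_mem // covW inE.
pose f (i : 'I_#|G|) : 'I_#|skeleton_structure W| :=
  enum_rank (exist (fun P => is_true (P \in W)) _ (pblockW (enum_val i)) : skeleton_structure W).
(* Quantifying over the whole part avoids choosing a representative: all its vertices have the same
   closed neighbourhood. *)
pose N : 'M[F]_(#|skeleton_structure W|, #|G|) :=
  (\matrix_(k, j) ([exists x in val (enum_val k : {P : {set G} | P \in W}),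
     (x == enum_val j) || adj x (enum_val j)])%:R)%R.
suff -> : (1%:M + adjacency_mx F G)%R = rowsub f N.
  by rewrite (leq_trans (mxrankS (rowsub_sub f N))) // rank_leq_row.
apply/matrixP=> i j; rewrite !mxE enum_rankK /=.
have memi : enum_val i \in pblock W (enum_val i) by rewrite mem_pblock covW inE.
(* Since there are no loops, the sum $I+A$ is a 0/1 matrix, the indicator of closed
   neighbourhoods. *)
transitivity ((((enum_val i == enum_val j) || adj (enum_val i) (enum_val j))%:R)%R : F).
  rewrite (inj_eq enum_val_inj); case: eqP => [->|_] /=.
    by rewrite adj_irrefl GRing.addr0.
  by rewrite GRing.add0r.
congr (nat_of_bool _)%:R%R; apply/idP/exists_inP => [ij | [x xP]].
  by exists (enum_val i).
exact: (complete_partition_closed_nbhd _ _ _ _ _ _ hW (pblockW _) xP memi).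
Qed.

Theorem theorem4p5 (R : realType) (G : sgraph) (W : {set {set G}})
    (hW : is_complete_skeleton W) :
  \rank (1%:M + adjacency_mx R G)%R <= #|skeleton_structure W|.
Proof. by case: hW => hW _; exact: complete_partition_rank. Qed.
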